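(* Let $r$ be a positive integer, let $0<a<b$ be real numbers, let $f(z)=z^{r+1}$, and let $P_{c}$ denote the Taylor polynomial to $f$ of order $r$ at $x=c$. Then all of the nonreal roots of $P_{b}-P_{a}$ have real part equal to the arithmetic mean $\frac{a+b}{2}$.
   Context: The Taylor polynomial to $f$ of order $r$ at $c$ is $P_c(z)=\sum_{k=0}^{r}\frac{f^{(k)}(c)}{k!}(z-c)^k$, regarded as a polynomial in the complex variable $z$. *)

(* Defs.v *)
From mathcomp Require Import all_boot all_order all_algebra.
From mathcomp Require Import complex.
From mathcomp Require Import reals normedtype derive.

Set Implicit Arguments.
Unset Strict Implicit.
Unset Printing Implicit Defensive.

Import GRing.Theory Num.Theory.
Import numFieldNormedType.Exports.

Local Open Scope ring_scope.

(* [derive1n k f] is the [k]-th analytic derivative of [f]; it is a total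
   operator, so the definition is meaningful when [f] is [r] times
   differentiable at [c]. *)
Definition taylor_poly (R : realType) (f : R -> R) (r : nat) (c : R) :
    {poly R} :=
  \sum_(k < r.+1) (derive1n k f c / k`!%:R) *: ('X - c%:P) ^+ k.

(* The same polynomial, viewed as a polynomial in a complex variable. *)
Definition complex_poly (R : realType) (p : {poly R}) : {poly R[i]} :=
  map_poly (real_complex R) p.

(* Main.v *)
(* By the binomial formula, expanding [z = c + (z - c)], the order [r] Taylor
   polynomial of [z ^ (r + 1)] at [c] is [z ^ (r + 1) - (z - c) ^ (r + 1)].
   Hence a root [z] of [P_b - P_a] satisfies
   [(z - a) ^ (r + 1) = (z - b) ^ (r + 1)], so [z] is equidistant from the
   distinct real points [a] and [b]. *)
Require Import Defs.
From mathcomp Require Import all_boot all_order all_algebra.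
From mathcomp Require Import complex lra.
From mathcomp Require Import boolp reals normedtype derive.

Import GRing.Theory Num.Theory.
Import numFieldNormedType.Exports.

Local Open Scope ring_scope.

Lemma derive1n_horner (R : realType) (p : {poly R}) (k : nat) :
  derive1n k (horner p) = horner p^`(k).
Proof.
elim: k => [|k IHk]; first by rewrite derivn0.
by rewrite derive1nS IHk derivnS derivE.
Qed.

Lemma taylor_poly_exp (R : realType) (r : nat) (c : R) :
  taylor_poly (fun x : R => x ^+ r.+1) r c = 'X^(r.+1) - ('X - c%:P) ^+ r.+1.
Proof.
have expand : 'X^(r.+1) = (c%:P + ('X - c%:P)) ^+ r.+1.
  by rewrite addrC subrK.
(* The top binomial term, [k = r.+1], is [('X - c%:P) ^+ r.+1] and cancels the subtracted power. *)
rewrite expand exprDn big_ord_recr /= subnn expr0 mul1r binn addrK.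
have -> : (fun x : R => x ^+ r.+1) = horner 'X^(r.+1).
  by apply/funext => x; rewrite hornerXn.
apply: eq_bigr => k _.
have kfact : (k`!%:R : R) != 0 by rewrite pnatr_eq0 -lt0n fact_gt0.
(* The [k]-th derivative brings out a falling factorial; dividing it by [k!] leaves the binomial
   coefficient. *)
rewrite derive1n_horner derivnXn hornerMn hornerXn -bin_ffact.
rewrite mulrnA -[X in X / _]mulr_natr mulfK // -mul_polyC polyCMn polyC_exp.
by rewrite mulrnAl.
Qed.

Lemma Re_equidistant (R : rcfType) (a b : R) (z : R[i]) : a != b ->
  `|z - a%:C%C| = `|z - b%:C%C| -> complex.Re z = (a + b) / 2.
Proof.
case: z => x y neq_ab /(congr1 (fun w => w ^+ 2)).
rewrite !sqr_normc /=.
simpc => -[/addIr eq_sqr _].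
apply/eqP; rewrite -subr_eq0.
(* $(x-a)^2-(x-b)^2 = -2(a-b)(x-\frac{a+b}{2})$, so [eq_sqr] makes this product vanish. *)
have : (x - (a + b) / 2) * (a - b) == 0 by apply/eqP; lra.
by rewrite mulf_eq0 [a - b == 0]subr_eq0 (negPf neq_ab) orbF.
Qed.

Theorem proposition3 (R : realType) (r : nat) (a b : R)
    (hr : (0 < r)%N) (ha : 0 < a) (hab : a < b) :
  let f := fun x : R => x ^+ r.+1 in
  forall z : R[i],
    root (complex_poly (taylor_poly f r b) - complex_poly (taylor_poly f r a)) z ->
    complex.Im z != 0 ->
    complex.Re z = (a + b) / 2.
Proof.
move=> f z; rewrite /complex_poly !taylor_poly_exp -rmorphB /= => zroot _.
have eq_pow : (z - a%:C%C) ^+ r.+1 = (z - b%:C%C) ^+ r.+1.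
  move: zroot; rewrite opprB addrC addrA subrK.
  rewrite rmorphB !rmorphXn !rmorphB /= map_polyX !map_polyC /= rootE.
  by rewrite !hornerE subr_eq0 => /eqP.
apply: Re_equidistant; first by rewrite Order.POrderTheory.lt_eqF.
(* Equal powers fix [z - a] only up to a root of unity; moduli are nonnegative, where [r.+1]-th
   powers are injective. *)
apply: (@pexpIrn _ r.+1); rewrite ?nnegrE ?normr_ge0 //.
by rewrite -!normrX eq_pow.
Qed.
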